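(* For any Veltman model $\mathcal{M}=\langle\mathcal{F},ev\rangle$, its ultrafilter extension $\mathcal{M}^{ue}$ is modally saturated. That is, for every world $a$ of $\mathcal{M}^{ue}$ and every set $\Sigma$ of formulas, the following holds: if for every finite $\Sigma'\subseteq\Sigma$ we have $\mathcal{M}^{ue},a\Vdash\Diamond\bigwedge\Sigma'$, then there is a world $b$ with $aR^{ue}b$ and $\mathcal{M}^{ue},b\Vdash\psi$ for all $\psi\in\Sigma$.
   Context: Formulas: $\alpha ::= p\mid\bot\mid\alpha\to\alpha\mid\Box\alpha\mid\alpha\triangleright\alpha$, with $\Diamond\alpha:=\neg\Box\neg\alpha$. A Veltman frame is $\langle W,R,\{S_w\}_{w\in W}\rangle$ where: - $W$ is nonempty. - $R$ is transitive and conversely well-founded. - Each $S_w$ is a reflexive transitive relation on $R[w]=\{v:wRv\}$ such that $uRv$ implies $uS_wv$ for $u,v\in R[w]$. A Veltman model adds a valuation $ev$ of atoms. Forcing: - $w\Vdash p$ iff $w\in ev(p)$. - $\bot$ is never forced; $\to$ is classical. - $w\Vdash\Box\alpha$ iff all $R$-successors force $\alpha$. - $w\Vdash\alpha\triangleright\beta$ iff for every $u$ with $wRu$ and $u\Vdash\alpha$ there is $v$ with $uS_wv$ and $v\Vdash\beta$. The same clauses are used for the ultrafilter extension. Notation for $X,Y\subseteq W$: - $\overline{Y}=W\setminus Y$. - $\widehat{R^{-1}}(Y)=\{x:\forall y(xRy\to y\in Y)\}$. - $S^{-1}(X,Y)=\{w:\forall x\in X(wRx\to\exists y\in Y\,xS_wy)\}$.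 $U(W)$ is the set of ultrafilters on $W$. For $l\subseteq\wp(W)\setminus\{\emptyset\}$ with the finite intersection property and $f,g\in U(W)$, write $f\prec_l g$ iff the following holds: for every $A\subseteq W$ and every finite (possibly empty) family $S_1,\dots,S_n\in l$, if $S^{-1}(\overline{A},\overline{S_1}\cup\dots\cup\overline{S_n})\in f$ then $A,\widehat{R^{-1}}(A)\in g$. Ultrafilter extension: - $W^{ue}$ is the smallest set of pairs $\langle f,\sigma\rangle$ ($f\in U(W)$, $\sigma$ a finite sequence of labels) containing $\langle f,\langle\rangle\rangle$ for all $f\in U(W)$, and containing $\langle g,\sigma^\frown\langle l\rangle\rangle$ whenever $\langle f,\sigma\rangle\in W^{ue}$ and $f\prec_l g$. - $R^{ue}$ is the transitive closure of $R^{ue}_{one}$, where $\langle f,\sigma\rangle R^{ue}_{one}\langle g,\sigma^\frown\langle l\rangle\rangle$ iff $f\prec_l g$. - $S^{ue}_{\langle f,\sigma\rangle}$ is the smallest reflexive transitive relation on $R^{ue}[\langle f,\sigma\rangle]$ that contains $R^{ue}\cap R^{ue}[\langle f,\sigma\rangle]^2$ and contains every pair $(\langle g,\tau\rangle,\langle h,\tau'\rangle)$ of $R^{ue}$-successors of $\langle f,\sigma\rangle$ whose entries immediately following the initial segment $\sigma$ coincide. - $ev^{ue}(p)=\{\langle f,\sigma\rangle\in W^{ue}: ev(p)\in f\}$. $\mathcal{M}^{ue}=\langle W^{ue},R^{ue},\{S^{ue}\},ev^{ue}\rangle$. *)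

(* Defs.v *)
From Stdlib Require List.
From Stdlib Require Import Relation_Operators.
From mathcomp Require Import all_boot.
From mathcomp Require Import boolp classical_sets cardinality filter.

Set Implicit Arguments.
Unset Strict Implicit.
Unset Printing Implicit Defensive.

Local Open Scope classical_set_scope.

Inductive formula (P : Type) : Type :=
| Var of P
| Bot
| Imp of formula P & formula P
| Box of formula P
| Rhd of formula P & formula P.

Arguments Bot {P}.

Definition Neg P (a : formula P) : formula P := Imp a Bot.
Definition Top {P} : formula P := Neg Bot.
Definition And P (a b : formula P) : formula P := Neg (Imp a (Neg b)).
Definition Dia P (a : formula P) : formula P := Neg (Box (Neg a)).
Definition BigAnd P (s : seq (formula P)) : formula P := foldr (@And P) Top s.

(* Bare relational data: forcing must also make sense on the ultrafilter
   extension, whose accessibility relation need not be conversely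
   well-founded.  [relS w u v] reads u S_w v. *)
Record frame : Type := Frame {
  world :> Type;
  relR : world -> world -> Prop;
  relS : world -> world -> world -> Prop
}.

Record is_veltman_frame (F : frame) : Prop := IsVeltmanFrame {
  veltman_inhabited : inhabited F;
  veltman_R_trans : forall x y z : F, relR x y -> relR y z -> relR x z;
  veltman_R_cwf : well_founded (fun x y : F => relR y x);
  veltman_S_dom : forall w u v : F, relS w u v -> relR w u /\ relR w v;
  veltman_S_refl : forall w u : F, relR w u -> relS w u u;
  veltman_S_trans : forall w x y z : F, relS w x y -> relS w y z -> relS w x z;
  veltman_S_R : forall w u v : F, relR w u -> relR w v -> relR u v -> relS w u v
}.

Record model (P : Type) : Type := Model {
  model_frame :> frame;
  ev : P -> set model_frame
}.

Definition is_veltman_model P (M : model P) : Prop := is_veltman_frame M.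

Fixpoint forces P (M : model P) (w : M) (a : formula P) : Prop :=
  match a with
  | Var p => ev p w
  | Bot => False
  | Imp b c => forces w b -> forces w c
  | Box b => forall u : M, relR w u -> forces u b
  | Rhd b c => forall u : M, relR w u -> forces u b ->
      exists v : M, relS w u v /\ forces v c
  end.

Definition modally_saturated P (M : model P) : Prop :=
  forall (a : M) (Sigma : set (formula P)),
    (forall s : seq (formula P),
       (forall psi, List.In psi s -> Sigma psi) -> forces a (Dia (BigAnd s))) ->
    exists b : M, relR a b /\ forall psi, Sigma psi -> forces b psi.

Section UltrafilterExtension.
Variable F : frame.

Definition Rinv_hat (Y : set F) : set F :=
  [set x | forall y, relR x y -> Y y].

Definition Sinv (X Y : set F) : set F :=
  [set w | forall x, X x -> relR w x -> exists2 y, Y y & relS w x y].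

Record ultra : Type := Ultra {
  ultra_sets : set_system F;
  ultraP : UltraFilter ultra_sets
}.

Record label : Type := Label {
  label_sets :> set_system F;
  label_nonempty : ~ label_sets set0;
  label_fip : finI label_sets id
}.

Definition prec (l : label) (f g : ultra) : Prop :=
  forall (A : set F) (D : set (set F)), finite_set D -> D `<=` l ->
    ultra_sets f (Sinv (~` A) (\bigcup_(X in D) ~` X)) ->
    ultra_sets g A /\ ultra_sets g (Rinv_hat A).

Inductive in_ue : ultra -> seq label -> Prop :=
| in_ue_nil f : in_ue f [::]
| in_ue_rcons f s l g : in_ue f s -> prec l f g -> in_ue g (rcons s l).

Record ue_world : Type := UeWorld {
  ue_ultra : ultra;
  ue_seq : seq label;
  ue_worldP : in_ue ue_ultra ue_seq
}.

Definition ue_Rone (a b : ue_world) : Prop :=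
  exists l : label,
    ue_seq b = rcons (ue_seq a) l /\ prec l (ue_ultra a) (ue_ultra b).

Definition ue_R : ue_world -> ue_world -> Prop := clos_trans ue_world ue_Rone.

Inductive ue_S (a : ue_world) : ue_world -> ue_world -> Prop :=
| ue_S_refl b : ue_R a b -> ue_S a b b
| ue_S_trans b c d : ue_S a b c -> ue_S a c d -> ue_S a b d
| ue_S_R b c : ue_R a b -> ue_R a c -> ue_R b c -> ue_S a b c
| ue_S_label b c (l : label) (t t' : seq label) :
    ue_R a b -> ue_R a c ->
    ue_seq b = ue_seq a ++ l :: t -> ue_seq c = ue_seq a ++ l :: t' ->
    ue_S a b c.

Definition ue_frame : frame := Frame ue_R ue_S.

End UltrafilterExtension.

Definition ue_model P (M : model P) : model P :=
  @Model P (ue_frame M) (fun p => [set a | ultra_sets (ue_ultra a) (ev p)]).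

(* Main.v *)
(** The truth lemma holds for the ultrafilter extension: a world [<f, s>]
    forces a formula iff the truth set of that formula belongs to [f].  Every
    existential step rests on one fact: a family [G] closed under binary
    intersections extends to an ultrafilter [g] with [prec l f g] as soon as
    no set [Sinv A (~S_1 U .. U ~S_n)], with [A] in [G] and the [S_i] in [l],
    belongs to [f].  For the empty label this condition says that [f] contains
    no [Rinv_hat (~ A)], which for truth sets of finite conjunctions is the
    hypothesis of saturation.  A formula [b |> c] failing at [<f, s>] is refuted
    with the label consisting of the complement of the truth set of [c] only. *)
Require Import Defs.
From Stdlib Require List.
From Stdlib Require Import Relation_Operators Operators_Properties.
From mathcomp Require Import all_boot.
From mathcomp Require Import boolp classical_sets cardinality filter.

Set Implicit Arguments.
Unset Strict Implicit.
Unset Printing Implicit Defensive.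

Local Open Scope classical_set_scope.

(** * Operators on sets of worlds, and small labels *)

Section Frame.
Variable F : frame.
Implicit Types (A B C X Y : set F) (f g : ultra F) (l : label F).

#[local] Existing Instance ultraP.

Lemma ultra_setC f A : ultra_sets f (~` A) <-> ~ ultra_sets f A.
Proof.
split=> [fnA fA|nfA]; last by have [] := in_ultra_setVsetC A (ultraP f).
by apply: (@filter_not_empty _ (ultra_sets f)); rewrite -(setICr A); apply: filterI.
Qed.

Lemma Sinv_set0 A : Sinv A set0 = Rinv_hat (~` A).
Proof.
apply/seteqP; split=> w wA x; first by move=> wx Ax; case: (wA x Ax wx).
by move=> Ax wx; case: (wA x wx Ax).
Qed.

Lemma SinvS A B X Y : A `<=` B -> X `<=` Y -> Sinv B X `<=` Sinv A Y.
Proof.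
move=> AB XY w wBX x Ax wx.
by have [y Xy xy] := wBX x (AB _ Ax) wx; exists y => //; apply: XY.
Qed.

Lemma Sinv_setU A B X : Sinv A X `&` Sinv B X `<=` Sinv (A `|` B) X.
Proof. by move=> w [wA wB] x [Ax|Bx] wx; [apply: wA|apply: wB]. Qed.

Lemma Rinv_hatI A B : Rinv_hat (A `&` B) = Rinv_hat A `&` Rinv_hat B.
Proof.
apply/seteqP; split=> [w wAB|w [wA wB] x wx]; last by split; [apply: wA|apply: wB].
by split=> x /wAB[].
Qed.

Lemma prec_Rinv_hat l f g A : prec l f g -> ultra_sets f (Rinv_hat A) ->
  ultra_sets g A /\ ultra_sets g (Rinv_hat A).
Proof.
move=> fg fA; apply: (fg A set0) => //.
by rewrite bigcup_set0 Sinv_set0 setCK.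
Qed.

Lemma exists_label0 : inhabited F -> exists l, l = set0 :> set_system F.
Proof.
move=> [w].
have fip : finI (set0 : set_system F) id.
  by move=> D D0; exists w => X /= /D0; rewrite inE.
by unshelve eexists (Label _ fip).
Qed.

Lemma exists_label1 X : X !=set0 -> exists l, l = [set X] :> set_system F.
Proof.
move=> [w Xw].
have fip : finI [set X] id.
  by move=> D DX; exists w => Y /= /DX; rewrite inE => ->.
have X0 : ~ [set X] set0 by move=> /= X0; rewrite -X0 in Xw.
by exists (Label X0 fip).
Qed.

(** * Existence of ultrafilters related by [prec] *)

Hypothesis hF : is_veltman_frame F.

Lemma Sinv_id A : Sinv A A = setT.
Proof.
by rewrite -subTset => w _ x Ax wx; exists x => //; apply: veltman_S_refl.
Qed.

Lemma Sinv_trans A B C : Sinv A B `&` Sinv B C `<=` Sinv A C.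
Proof.
move=> w [wAB wBC] x Ax wx.
have [y By xy] := wAB x Ax wx.
have [z Cz yz] := wBC y By (veltman_S_dom hF xy).2.
by exists z => //; apply: veltman_S_trans xy yz.
Qed.

(** A point of [A] either lies outside [C] or sees a point outside [C]. In the second case that
    point is also an [S_w]-successor, because [R] is transitive and contained in [S_w] on successors
    of [w]. *)
Lemma Sinv_Rinv_hat A C Y : C `&` Rinv_hat C `&` A = set0 ->
  Sinv (~` C) Y `<=` Sinv A Y.
Proof.
move=> CA0 w wCY x Ax wx; have [Cx|] := pselect (C x); last by move=> /wCY; apply.
have /existsNP[z /not_implyP[xz nCz]] : ~ Rinv_hat C x.
  by move=> RCx; have : set0 x by rewrite -CA0.
have wz := veltman_R_trans hF wx xz.
have [y Yy zy] := wCY z nCz wz.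
by exists y => //; apply: veltman_S_trans zy => //; apply: veltman_S_R.
Qed.

(** The sets that [prec] forces into [g], together with [G], generate the filter [H]. One triple
    [C], [D], [A] suffices for each member, since two triples merge by intersecting the [C]s and the
    [A]s and uniting the [D]s. If [H] were improper, [Sinv_Rinv_hat] would contradict the hypothesis
    on [f]. *)
Lemma prec_extension f l (G : set_system F) : G !=set0 -> setI_closed G ->
  (forall A D, G A -> finite_set D -> D `<=` l ->
     ~ ultra_sets f (Sinv A (\bigcup_(X in D) ~` X))) ->
  exists2 g, prec l f g & G `<=` ultra_sets g.
Proof.
move=> [A0 GA0] GI Gf.
pose H : set_system F := [set Z | exists C D A, [/\ finite_set D, D `<=` l,
  ultra_sets f (Sinv (~` C) (\bigcup_(X in D) ~` X)), G A &
  C `&` Rinv_hat C `&` A `<=` Z]].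
(* Taking [C] to be the whole space makes the condition vacuous, so members of [G] enter [H] on
   their own. *)
have fT Y : ultra_sets f (Sinv (~` setT) Y).
  by apply: filterS filterT => w _ x; rewrite setCT.
have HP : ProperFilter H.
  split=> [[C [D [A [finD Dl fC GA]]]]|].
    rewrite subset0 => /Sinv_Rinv_hat CA; apply: (Gf A D) => //.
    exact: filterS fC.
  split=> [|Z Z' [C [D [A [finD Dl fC GA CZ]]]]
             [C' [D' [A' [finD' Dl' fC' GA' CZ']]]]|Z Z' ZZ'].
  - by exists setT, set0, A0; split=> //; apply: fT.
  - exists (C `&` C'), (D `|` D'), (A `&` A'); split.
    + by rewrite finite_setU.
    + by rewrite subUset.
    + rewrite bigcup_setU setCI; apply: filterS (filterI fC fC') => w [wC wC'].
      by apply: Sinv_setU; split;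
        [apply: SinvS wC => // x; left|apply: SinvS wC' => // x; right].
    + exact: GI.
    + by rewrite Rinv_hatI => x [[[Cx C'x] [RCx RC'x]] [Ax A'x]]; split;
        [apply: CZ|apply: CZ'].
  - move=> [C [D [A [finD Dl fC GA CZ]]]]; exists C, D, A; split=> //.
    exact: subset_trans ZZ'.
have [g [gU Hg]] := ultraFilterLemma HP.
exists (Ultra gU) => [A D finD Dl fA|A GA] /=.
  by split; apply: Hg; exists A, D, A0; split=> // x [[]].
by apply: Hg; exists setT, set0, A; split=> // x [].
Qed.

Lemma prec_extension1 f l A :
  (forall D, finite_set D -> D `<=` l ->
     ~ ultra_sets f (Sinv A (\bigcup_(X in D) ~` X))) ->
  exists2 g, prec l f g & ultra_sets g A.
Proof.
move=> fA; have [||B D ->|g fg gA] := @prec_extension f l [set A].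
- by exists A.
- by move=> B C -> ->; rewrite setIid.
- exact: fA.
- by exists g => //; apply: gA.
Qed.

Lemma prec_extension_Rinv_hat f (G : set_system F) : G !=set0 -> setI_closed G ->
  (forall A, G A -> ~ ultra_sets f (Rinv_hat (~` A))) ->
  exists l, exists2 g, prec l f g & G `<=` ultra_sets g.
Proof.
move=> G0 GI Gf; have [l l0] := exists_label0 (veltman_inhabited hF).
exists l; apply: prec_extension => // A D GA _.
by rewrite l0 subset0 => ->; rewrite bigcup_set0 Sinv_set0; apply: Gf.
Qed.

(** An obstruction to extending [B] would compose with [Sinv A B] into one for [A], and [prec l f g]
    would then put both excluded sets into [g]. *)
Lemma prec_Sinv f l g A B : prec l f g -> ultra_sets f (Sinv A B) ->
  ~ (ultra_sets g (~` A) /\ ultra_sets g (Rinv_hat (~` A))) ->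
  exists2 h, prec l f h & ultra_sets h B.
Proof.
move=> fg fAB gA; apply: prec_extension1 => D finD Dl fB; apply: gA.
apply: (fg _ D) => //; rewrite setCK.
by apply: filterS (filterI fAB fB); apply: Sinv_trans.
Qed.

Lemma prec_not_Sinv f A B : ~ ultra_sets f (Sinv A B) ->
  exists l, (exists2 g, prec l f g & ultra_sets g A) /\
  forall h, prec l f h -> ultra_sets h (~` B) /\ ultra_sets h (Rinv_hat (~` B)).
Proof.
move=> nfAB.
have [l lB] : exists l, l = [set ~` B] :> set_system F.
  (* A label needs a nonempty member: if [B] were everything, [Sinv A B] would be everything too. *)
  apply: exists_label1; apply/set0P/eqP => B0; apply: nfAB.
  apply: filterS filterT; rewrite -(Sinv_id A); apply: SinvS => // x _.
  by rewrite -(setCK B) B0.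
exists l; split=> [|h fh]; last first.
  (* With this choice the premise of [prec] is about [Sinv B B], which is the whole space. *)
  apply: (fh _ [set ~` B]); [exact: finite_set1|by rewrite lB|].
  by rewrite bigcup_set1 setCK Sinv_id; apply: filterT.
apply: prec_extension1 => D _; rewrite lB => DB fAD; apply: nfAB.
by apply: filterS fAD; apply: SinvS => // x [X /DB ->]; rewrite setCK.
Qed.

End Frame.

(** * Successors and labels in the ultrafilter extension *)

Section Extension.
Variable F : frame.
Implicit Types (a b c : ue_world F) (A : set F) (l : label F).

Lemma ue_R_seq a b : ue_R a b -> exists t, ue_seq b = ue_seq a ++ t.
Proof.
elim=> [x y [l [-> _]]|x y z _ [t ty] _ [t' tz]].
  by exists [:: l]; rewrite cats1.
by exists (t ++ t'); rewrite tz ty catA.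
Qed.

Lemma ue_R_ultra a b A : ue_R a b -> ultra_sets (ue_ultra a) (Rinv_hat A) ->
  ultra_sets (ue_ultra b) A /\ ultra_sets (ue_ultra b) (Rinv_hat A).
Proof.
elim=> [x y [l [_ xy]]|x y z _ xy _ yz /xy[_ /yz]//].
exact: prec_Rinv_hat xy.
Qed.

(** Here [g] is the ultrafilter reached by the first step of a chain from [a] to [b]; later steps
    only append labels and preserve [Rinv_hat A]. *)
Lemma ue_R_first a b : ue_R a b -> exists l t g,
  [/\ ue_seq b = ue_seq a ++ l :: t, prec l (ue_ultra a) g &
      forall A, ultra_sets g A /\ ultra_sets g (Rinv_hat A) ->
                ultra_sets (ue_ultra b) A].
Proof.
move/clos_trans_t1n_iff.
case=> [c [l [cE ac]]|c d [l [cE ac]] /clos_trans_t1n_iff cd].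
  by exists l, [::], (ue_ultra c); split=> // [|A []]; rewrite // cE cats1.
have [t dE] := ue_R_seq cd.
exists l, t, (ue_ultra c); split=> // [|A [_ /(ue_R_ultra cd)[]//]].
by rewrite dE cE cat_rcons.
Qed.

(** No generating clause of [ue_S a] changes the entry right after [ue_seq a]: [R]-steps only extend
    the sequence. *)
Lemma ue_S_first a b c l t : ue_S a b c -> ue_seq b = ue_seq a ++ l :: t ->
  ue_R a c /\ exists t', ue_seq c = ue_seq a ++ l :: t'.
Proof.
move=> abc; elim: abc t => {b c}[b ab t bE|b c d _ bc _ cd t /bc[_ [t' /cd]]//|
    b c ab ac bc t bE|b c m t t' ab ac bE cE s].
- by split=> //; exists t.
- split=> //; have [t' ->] := ue_R_seq bc.
  by exists (t ++ t'); rewrite bE -catA.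
- rewrite bE => /(@List.app_inv_head _ _ _ _)[<- _].
  by split=> //; exists t'.
Qed.

Lemma ue_R_one a l g : prec l (ue_ultra a) g ->
  exists b, [/\ ue_R a b, ue_ultra b = g & ue_seq b = rcons (ue_seq a) l].
Proof.
move=> ag; have bP := in_ue_rcons (ue_worldP a) ag.
by exists (UeWorld bP); split=> //; apply: t_step; exists l.
Qed.

End Extension.

(** * Truth lemma and saturation *)

Definition truth_set P (M : model P) (phi : formula P) : set M :=
  [set w | forces w phi].
Arguments truth_set {P} M phi.

Lemma truth_set_And P (M : model P) (phi psi : formula P) :
  truth_set M (And phi psi) = truth_set M phi `&` truth_set M psi.
Proof.
apply/seteqP; split=> w /=; last by move=> [wphi wpsi]; apply.
by move=> /not_implyP[wphi /contrapT].
Qed.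

Lemma truth_set_Rhd P (M : model P) (phi psi : formula P) :
  truth_set M (Rhd phi psi) = Sinv (truth_set M phi) (truth_set M psi).
Proof.
apply/seteqP; split=> w wphi u.
  by move=> uphi wu; have [v []] := wphi u wu uphi; exists v.
by move=> wu uphi; have [v] := wphi u uphi wu; exists v.
Qed.

Lemma forces_BigAnd P (M : model P) (w : M) (s : seq (formula P)) :
  forces w (BigAnd s) <-> forall psi, List.In psi s -> forces w psi.
Proof.
elim: s => [|phi s IHs]; first by split=> // _ /=.
rewrite -[forces w _]/(truth_set M (And phi (BigAnd s)) w) truth_set_And.
split=> [[wphi /IHs ws] psi [<-//|/ws//]|ws].
by split; [apply: ws; left|apply/IHs => psi ?; apply: ws; right].
Qed.

Lemma ue_truth P (M : model P) (hM : is_veltman_model M) (phi : formula P)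
    (a : ue_model M) :
  forces a phi <-> ultra_sets (ue_ultra a) (truth_set M phi).
Proof.
have uP (f : ultra M) : UltraFilter (ultra_sets f) := ultraP f.
elim: phi a => [p||b IHb c IHc|b IHb|b IHb c IHc] a.
- by [].
- by split=> //; apply: filter_not_empty.
- split=> [abc|fbc /IHb fb]; last first.
    by apply/IHc; apply: filterS (filterI fbc fb) => w [bc /bc].
  have [/IHb/abc/IHc|/ultra_setC] :=
    pselect (ultra_sets (ue_ultra a) (truth_set M b)).
    by apply: filterS => w ? ?.
  by apply: filterS => w nb /nb.
- split=> [ab|fb u au]; last by apply/IHb; apply: (ue_R_ultra au fb).1.
  apply: contrapT => nfb.
  have [|||l [g ag gb]] :=
    @prec_extension_Rinv_hat _ hM (ue_ultra a) [set ~` truth_set M b].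
  + by exists (~` truth_set M b).
  + by move=> B C -> ->; rewrite setIid.
  + by move=> A ->; rewrite setCK.
  have [u [au ug _]] := ue_R_one ag.
  by have /IHb := ab u au; rewrite ug; apply/ultra_setC; apply: gb.
- rewrite truth_set_Rhd; split=> [abc|fbc u au /IHb ub].
    apply: contrapT => /(prec_not_Sinv hM)[l [[g ag gb] lc]].
    have [u [au ug uE]] := ue_R_one ag.
    have /(abc u au)[v [auv /IHc]] : @forces _ (ue_model M) u b.
      by apply/IHb; rewrite ug.
    apply/ultra_setC.
    (* Although [v] may be many steps from [a], its first step carries the label [l], so [lc]
       excludes [c] there and at all later steps. *)
    rewrite -cats1 in uE; have [av [t vE]] := ue_S_first auv uE.
    have [l' [t' [h [vE' ah]]]] := ue_R_first av; apply.
    by apply: lc; move: vE'; rewrite vE => /(@List.app_inv_head _ _ _ _)[-> _].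
  have [l [t [g [uE ag gu]]]] := ue_R_first au.
  (* The first step [g] towards [u] cannot rule out [b] at itself and all later steps, as [u] forces
     [b]. The resulting [h] is reached by the same label, hence is [S]-accessible from [u]. *)
  have [|h ah hc] := prec_Sinv hM ag fbc.
    by move=> /gu /ultra_setC.
  have [v [av vh vE]] := ue_R_one ah.
  exists v; split; last by apply/IHc; rewrite vh.
  by apply: ue_S_label uE _ => //; rewrite vE -cats1.
Qed.

Theorem theorem6p6 (P : Type) (M : model P) (hM : is_veltman_model M) :
  modally_saturated (ue_model M).
Proof.
move=> a Sigma Sa.
pose G : set_system M := [set A | exists2 s,
  forall psi, List.In psi s -> Sigma psi & A = truth_set M (BigAnd s)].
have [|||l [g ag Gg]] := @prec_extension_Rinv_hat _ hM (ue_ultra a) G.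
- by exists (truth_set M (BigAnd [::])); exists [::].
- move=> _ _ [s sS ->] [s' sS' ->]; exists (s ++ s').
    by move=> psi /(@List.in_app_or _ _ _ _)[/sS|/sS'].
  apply/seteqP; split=> w /=.
    move=> [/forces_BigAnd ws /forces_BigAnd ws']; apply/forces_BigAnd => psi.
    by move=> /(@List.in_app_or _ _ _ _)[/ws|/ws'].
  move=> /forces_BigAnd ws; split; apply/forces_BigAnd => psi spsi; apply: ws.
    by apply: List.in_or_app; left.
  by apply: List.in_or_app; right.
(* The truth set of [Box (Neg phi)] is, by computation, [Rinv_hat] of the complement of that of
   [phi]. *)
- by move=> _ [s sS ->] fs; apply: (Sa s sS); apply/(ue_truth hM (Box (Neg _))).
have [b [ab bg _]] := ue_R_one ag.
exists b; split=> // psi Spsi; apply/(ue_truth hM); rewrite bg; apply: Gg.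
exists [:: psi]; first by move=> _ [<-|[]].
by rewrite /= truth_set_And; apply/seteqP; split=> [w|w []//]; split=> //= [].
Qed.
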